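(* Let $m\ge 2$ be an integer and let $Y_1,Y_2,\ldots$ be independent, identically distributed random variables with values in $\{0,1,2,\ldots\}$ and common probability function $f(y)=\mathbb{P}(Y_1=y)$, where $f(y)=0$ for $y\notin\{0,1,\ldots,m\}$ and $f(m)>0$. Assume $\mathbb{E}(Y_1)<1$. For an integer $u\ge 0$ consider the Gerber–Dickson risk process $$U(t)=u+t-\sum_{j=1}^{t}Y_j,\qquad t=0,1,2,\ldots,$$ the time of ruin $\tau=\min\{t\ge 1: U(t)\le 0\}$ (with $\min\emptyset=\infty$), and the ultimate ruin probability $\psi(u)=\mathbb{P}(\tau<\infty\mid U(0)=u)$. Define $$\alpha_0=\frac{1-f(1)}{f(0)},\qquad \alpha_k=-\frac{f(k+1)}{f(0)}\quad (k=1,\ldots,m-1).$$ Then: (i) $\psi$ satisfies the linear recurrence $$\psi(u+m+1)=\sum_{k=0}^{m-1}\alpha_k\,\psi(u+m-k)\qquad\text{for all } u\ge 0;$$ (ii) if $z_1,\ldots,z_\ell$ are the distinct (possibly complex) roots of the characteristic polynomial $$p(y)=y^m-\sum_{k=0}^{m-1}\alpha_k\,y^{m-1-k},$$ with multiplicities $n_1,\ldots,n_\ell$ respectively (so $n_1+\cdots+n_\ell=m$), then there exist constants $b_{k,j}\in\mathbb{C}$ ($1\le k\le \ell$, $1\le j\le n_k$) such that $$\psi(u)=\sum_{k=1}^{\ell}\sum_{j=1}^{n_k} b_{k,j}\,u^{j-1}\,z_k^{u}\qquad\text{for all } u\ge 1.$$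
   Context: The net profit condition $\mathbb{E}(Y_1)<1$ implies $f(0)>0$, so the coefficients $\alpha_k$ are well defined. The constants $b_{k,j}$ are those matching the values $\psi(1),\ldots,\psi(m)$. *)

(* Defs.v *)
From HB Require Import structures.
From mathcomp Require Import all_boot all_order all_algebra.
From mathcomp Require Import all_classical all_reals all_analysis.
From mathcomp Require Import complex.
Set Implicit Arguments. Unset Strict Implicit. Unset Printing Implicit Defensive.
Import Order.TTheory GRing.Theory Num.Theory.
Local Open Scope classical_set_scope.
Local Open Scope ring_scope.

(* Convention: Y j is the paper's Y_{j+1} (j = 0,1,2,...). *)

Section Defs.
Context (d : measure_display) (T : measurableType d) (R : realType).

Definition mutually_independent_nat (P : probability T R) (Y : nat -> T -> nat) :=
  forall (J : seq nat) (y : nat -> nat), uniq J ->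
    P (\big[setI/setT]_(j <- J) [set w | Y j w = y j]) =
    (\prod_(j <- J) P [set w | Y j w = y j])%E.

(* U(t) = u + t - sum_{j=1}^t Y_j <= 0  iff  u + t <= sum_{j<t} Y j *)
Definition ruin_event (Y : nat -> T -> nat) (u : nat) : set T :=
  [set w | exists t : nat, (0 < t)%N /\ (u + t <= \sum_(j < t) Y j w)%N].

Definition psi (P : probability T R) (Y : nat -> T -> nat) (u : nat) : R :=
  fine (P (ruin_event Y u)).

End Defs.

Definition alpha (R : realType) (f : nat -> R) (k : nat) : R :=
  if k == 0%N then (1 - f 1%N) / f 0%N else - (f k.+1 / f 0%N).

Definition ruin_char_poly (R : realType) (f : nat -> R) (m : nat) : {poly complex R} :=
  'X^m - \sum_(k < m) (((alpha f k)%:C)%C)%:P * 'X^(m.-1 - k).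

(* Main.v *)
(* Decomposing on the first claim gives psi(u) = sum_v f(v) psi(u+1-v) + P(Y > u); for u >= m
   the last term vanishes, and solving for psi(u+1), which f(0) > 0 allows, is the recurrence.
   The decomposition is proved for ruin within a finite horizon, where only the independence of
   finitely many claims is involved, and passes to the limit.

   For the closed form, let L be the linear functional on C[X] with L(X^u) = psi(u+1).  The
   recurrence says that L vanishes on the ideal (p).  By the Chinese remainder theorem
   X^u = sum_k e_k X^u mod p, where p divides e_k (X - z_k)^(n_k); expanding X = z_k + (X - z_k)
   then gives psi(u+1) = sum_k sum_(j < n_k) C(u, j) z_k^(u-j) L(e_k (X - z_k)^j). *)

Require Import Defs.
From HB Require Import structures.
From mathcomp Require Import all_boot all_order all_algebra.
From mathcomp Require Import all_classical all_reals all_analysis.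
From mathcomp Require Import complex ring lra zify.
Import Order.TTheory GRing.Theory Num.Theory numFieldNormedType.Exports.
Local Open Scope classical_set_scope.
Local Open Scope ring_scope.

(** * The linear functional on polynomials attached to a sequence *)

Definition umbral (F : fieldType) (s : nat -> F) (q : {poly F}) : F :=
  \sum_(i < size q) q`_i * s i.

Lemma umbral_wide (F : fieldType) (s : nat -> F) (q : {poly F}) (N : nat) :
  (size q <= N)%N -> umbral F s q = \sum_(i < N) q`_i * s i.
Proof.
move=> qN; rewrite /umbral (big_ord_widen N (fun i => q`_i * s i)) // big_mkcond.
by apply: eq_bigr => i _; case: ltnP => // ?; rewrite nth_default ?mul0r.
Qed.

Lemma umbral_is_linear (F : fieldType) (s : nat -> F) : scalar (umbral F s).
Proof.
move=> a p q; set N := maxn (size p) (size q).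
rewrite !(umbral_wide _ _ _ N) ?leq_maxl ?leq_maxr //; last first.
  by rewrite (leq_trans (size_polyD _ _)) // geq_max leq_maxr andbT
    (leq_trans (size_scale_leq _ _)) // leq_maxl.
rewrite mulr_sumr -big_split /=; apply: eq_bigr => i _.
by rewrite coefD coefZ mulrDl mulrA.
Qed.

HB.instance Definition _ (F : fieldType) (s : nat -> F) :=
  GRing.isLinear.Build F {poly F} F _ (umbral F s) (umbral_is_linear F s).

Lemma umbralXn (F : fieldType) (s : nat -> F) (u : nat) : umbral F s 'X^u = s u.
Proof.
rewrite (umbral_wide _ _ _ u.+1) ?size_polyXn // big_ord_recr /= coefXn eqxx mul1r.
by rewrite big1 ?add0r // => i _; rewrite coefXn ltn_eqF ?mul0r.
Qed.

(** The hypothesis is the recurrence with characteristic polynomial [p]. Expanding the cofactor of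
    [p] in monomials extends it by linearity to the whole ideal. *)
Lemma umbral_dvdp (F : fieldType) (s : nat -> F) (p q : {poly F}) :
  (forall u, umbral F s (p * 'X^u) = 0) -> p %| q -> umbral F s q = 0.
Proof.
move=> ps /dvdpP[r ->]; rewrite -[r]coefK poly_def mulr_suml linear_sum big1 //= => i _.
by rewrite -scalerAl linearZ /= [_ * p]mulrC ps mulr0.
Qed.

(** * Chinese remainders and the closed form of linear recurrences *)

Lemma prod_dvdp (F : fieldType) (I : eqType) (r : seq I) (q : I -> {poly F}) (p : {poly F}) :
  uniq r -> {in r &, forall i j, i != j -> coprimep (q i) (q j)} ->
  {in r, forall i, q i %| p} -> \prod_(i <- r) q i %| p.
Proof.
elim: r => [|i r IH] /=; first by rewrite big_nil dvd1p.
move=> /andP[ir ur] co dv; rewrite big_cons Gauss_dvdp.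
  rewrite dv ?mem_head //=; apply: IH => // [j k jr kr|j jr].
    by apply: co; rewrite inE ?jr ?kr orbT.
  by apply: dv; rewrite inE jr orbT.
rewrite big_seq; elim/big_rec: _ => [|j x jr cx]; first exact: coprimep1.
rewrite coprimepMr cx andbT; apply: co; rewrite ?mem_head ?inE ?jr ?orbT //.
by apply: contraNneq ir => ->.
Qed.

(** Bezout gives [e k] divisible by every [q i] with [i != k] and congruent to 1 modulo [q k]. The
    sum of the [e k] is then 1 modulo each factor, hence modulo their product. *)
Lemma crt_idempotents (F : fieldType) (l : nat) (q : 'I_l -> {poly F}) :
  (forall i j, i != j -> coprimep (q i) (q j)) ->
  exists e : 'I_l -> {poly F},
    (forall k, \prod_(i < l) q i %| e k * q k) /\ \prod_(i < l) q i %| 1 - \sum_(k < l) e k.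
Proof.
move=> co; pose Q k := \prod_(i < l | i != k) q i.
have H k : exists e, Q k %| e /\ q k %| 1 - e.
  have /Bezout_eq1_coprimepP[[u v] /= uv] : coprimep (q k) (Q k).
    rewrite /Q; elim/big_rec: _ => [|j x jk cx]; first exact: coprimep1.
    by rewrite coprimepMr cx andbT; apply: co; rewrite eq_sym.
  by exists (v * Q k); rewrite dvdp_mull // -uv addrK dvdp_mull.
have [e He] := choice H; exists e; split=> [k|].
  rewrite (bigD1 k) //= mulrC dvdp_mul //.
  by have [] := He k.
apply: prod_dvdp => [|i j _ _|k _]; [exact: index_enum_uniq|exact: co|].
rewrite (bigD1 k) //= opprD addrA dvdp_sub //; first by have [] := He k.
apply: (big_ind (dvdp (q k))) => [|x y dx dy|i ik].
- exact: dvdp0.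
- by rewrite dvdp_add.
have [+ _] := He i; apply: dvdp_trans; rewrite /Q (bigD1 k) 1?eq_sym //=.
by rewrite dvdp_mulr.
Qed.

(** Induction through (j+1) C(u, j+1) = (u-j) C(u, j); for u < j both sides vanish, so truncated
    subtraction does no harm. The size bound later keeps the degree in u below the multiplicity of
    the root. *)
Lemma bin_poly (F : numFieldType) (j : nat) :
  exists q : {poly F}, (size q <= j.+1)%N /\ forall u : nat, 'C(u, j)%:R = q.[u%:R].
Proof.
elim: j => [|j [q [sq qE]]].
  by exists 1; rewrite size_poly1; split=> // u; rewrite bin0 hornerC.
exists (j.+1%:R^-1 *: (q * ('X - j%:R%:P))); split=> [|u].
  rewrite (leq_trans (size_scale_leq _ _)) // (leq_trans (size_polyMleq _ _)) //.
  by rewrite size_XsubC addn2.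
rewrite hornerZ hornerM hornerXsubC -qE; apply: (mulfI (x := j.+1%:R)).
  by rewrite pnatr_eq0.
rewrite mulrA mulfV ?pnatr_eq0 // mul1r -natrM mul_bin_left mulnC natrM.
have [uj|ju] := ltnP u j; first by rewrite bin_small // !mul0r.
by rewrite natrB.
Qed.

Lemma linear_recurrence_solution (F : numFieldType) (s : nat -> F) (p : {poly F})
  (l : nat) (z : 'I_l -> F) (n : 'I_l -> nat) :
  (forall u, umbral F s (p * 'X^u) = 0) -> injective z -> (forall k, z k != 0) ->
  p = \prod_(k < l) ('X - (z k)%:P) ^+ n k ->
  exists q : 'I_l -> {poly F}, (forall k, (size (q k) <= n k)%N) /\
    forall u, s u = \sum_(k < l) (q k).[u%:R] * z k ^+ u.
Proof.
move=> sp zinj z0 pE.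
have [|e [eq1 esum]] := @crt_idempotents F l (fun k => ('X - (z k)%:P) ^+ n k).
  move=> i j ij; apply/coprimep_expl/coprimep_expr/coprimep_XsubC2.
  by rewrite subr_eq0 eq_sym; apply: contraNneq ij => /zinj ->.
rewrite -pE in eq1 esum.
have [B HB] := choice (bin_poly F).
(* The factor [z k ^- j] turns z_k^(u-j) into z_k^u, which is where nonzero roots are needed. *)
exists (fun k => \sum_(j < n k)
  (umbral F s (e k * ('X - (z k)%:P) ^+ j) * z k ^- j) *: B j); split=> [k|u].
  apply: (leq_trans (size_sum _ _ _)); apply/bigmax_leqP => j _.
  by rewrite (leq_trans (size_scale_leq _ _)) // (leq_trans (HB j).1).
rewrite -umbralXn.
have -> : umbral F s 'X^u = umbral F s ((\sum_(k < l) e k) * 'X^u).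
  apply/eqP; rewrite -subr_eq0 -linearB /= -{1}['X^u]mul1r -mulrBl.
  by apply/eqP/umbral_dvdp; [exact: sp|rewrite dvdp_mulr].
rewrite mulr_suml linear_sum /=; apply: eq_bigr => k _.
rewrite -[X in _ * X ^+ _](subrK (z k)%:P) addrC exprDn mulr_sumr linear_sum /=.
pose G j := umbral F s (e k * ('X - (z k)%:P) ^+ j) * z k ^- j * 'C(u, j)%:R * z k ^+ u.
transitivity (\sum_(j < u.+1) G j).
  apply: eq_bigr => j _; rewrite /G -polyC_exp [in LHS]mulrnAr linearMn /=.
  rewrite mulrCA mul_polyC linearZ /= -mulr_natr.
  have -> : z k ^+ u = z k ^+ j * z k ^+ (u - j) by rewrite -exprD subnKC // -ltnS.
  by rewrite ?mul1r; field; rewrite expf_neq0.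
(* The binomial theorem gives j <= u, the witness j < n_k; both sums are padded to a common range.
   Terms with j > u vanish because C(u, j) = 0, those with j >= n_k because [p] divides e_k (X -
   z_k)^j. *)
rewrite horner_sum mulr_suml.
transitivity (\sum_(j < maxn u.+1 (n k)) G j).
  rewrite (big_ord_widen _ _ (leq_maxl _ (n k))) big_mkcond; apply: eq_bigr => j _.
  by case: ltnP => // uj; rewrite /G bin_small // mulr0 mul0r.
transitivity (\sum_(j < n k) G j); last first.
  by apply: eq_bigr => j _; rewrite hornerZ -(HB j).2.
rewrite [RHS](big_ord_widen _ _ (leq_maxr u.+1 (n k))) [RHS]big_mkcond; apply: eq_bigr => j _.
case: ltnP => // nj; rewrite /G (@umbral_dvdp _ _ p) ?mul0r //.
by rewrite -(subnKC nj) exprD mulrA dvdp_mulr.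
Qed.

(** * Ruin within a finite horizon, for a fixed sequence of claims *)

Fixpoint ruined_by (N u : nat) (a : nat -> nat) : bool :=
  if N is N'.+1 then (u < a 0%N)%N || ruined_by N' (u.+1 - a 0%N) (a \o succn)
  else false.

(** Ruin at time 1 means u + 1 <= a_0. Otherwise the process restarts one step later from capital u
    + 1 - a_0, which is positive, so the subtraction is not truncated. *)
Lemma ruined_byP (N u : nat) (a : nat -> nat) :
  ruined_by N u a <->
  exists t : nat, [/\ (0 < t)%N, (t <= N)%N & (u + t <= \sum_(j < t) a j)%N].
Proof.
have sumS t (b : nat -> nat) : (\sum_(j < t.+1) b j = b 0 + \sum_(j < t) (b \o succn) j)%N.
  by rewrite big_ord_recl.
elim: N u a => [|N IH] u a /=.
  by split=> // -[t [t0 tN _]]; move: t0; rewrite lt0n -leqn0 tN.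
have [ua|au] := ltnP u (a 0%N) => /=.
  by split=> // _; exists 1%N; rewrite big_ord1 addn1.
rewrite IH; split=> -[t [t0 tN ut]].
  by exists t.+1; split=> //; rewrite sumS; lia.
case: t t0 tN ut => // -[|t] _ tN; rewrite sumS => ut.
  by move: ut; rewrite big_ord0 addn0 addn1 ltnNge au.
by exists t.+1; split=> //; lia.
Qed.

(** * Ruin probabilities: first-claim decomposition and recurrence *)

Section RuinProbability.
Context (d : measure_display) (T : measurableType d) (R : realType).
Context (P : probability T R) (Y : nat -> T -> nat) (f : nat -> R) (m : nat).
Context (mY : forall j y, measurable [set w | Y j w = y]).
Context (indY : mutually_independent_nat P Y).
Context (fY : forall j y, fine (P [set w | Y j w = y]) = f y).
Context (f_eq0 : forall y, (m < y)%N -> f y = 0).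

Lemma prob_eq (j y : nat) : P [set w | Y j w = y] = (f y)%:E.
Proof. by rewrite -(fY j) fineK // fin_num_measure. Qed.

Lemma prob_total (k : nat) (E : set T) : measurable E ->
  P E = (\sum_(v < m.+1) P (E `&` [set w | Y k w = v]))%E.
Proof.
move=> mE.
have {1}-> : E = \bigcup_v (E `&` [set w | Y k w = v]).
  by apply/seteqP; split=> [w Ew|w [v _ []//]]; exists (Y k w).
have mEv v : measurable (E `&` [set w | Y k w = v]) by exact: measurableI.
rewrite measure_semi_bigcup //; first last.
- exact: bigcupT_measurable.
- apply/trivIsetP => i j _ _ /eqP ij; apply/seteqP; split=> // w /= [[_ iE] [_ jE]].
  by apply: ij; rewrite -iE -jE.
rewrite (@nneseries_split _ _ 0%N m.+1); last by move=> *; exact: measure_ge0.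
rewrite add0n eseries0 ?adde0 ?big_mkord // => v mv _.
apply/eqP; rewrite eq_le measure_ge0 andbT.
have <- : P [set w | Y k w = v] = 0%E by rewrite prob_eq f_eq0.
by apply: le_measure; rewrite ?inE.
Qed.

Definition ruined_from (k N u : nat) : set T :=
  [set w | ruined_by N u (fun j => Y (k + j)%N w)].

Lemma ruined_fromS (k N u v : nat) :
  ruined_from k N.+1 u `&` [set w | Y k w = v] =
  (if (u < v)%N then setT else ruined_from k.+1 N (u.+1 - v)) `&` [set w | Y k w = v].
Proof.
apply/seteqP; split=> w [+ /= kv]; rewrite /ruined_from /= addn0 kv.
all: rewrite (_ : (fun j => _) \o _ = fun j => Y (k.+1 + j)%N w).
all: try by apply/funext => j /=; rewrite addSnnS.
all: by case: ifP.
Qed.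

Lemma measurable_ruined_from (k N u : nat) : measurable (ruined_from k N u).
Proof.
elim: N k u => [|N IH] k u.
  by rewrite (_ : ruined_from _ _ _ = set0) //; apply/seteqP; split.
rewrite (_ : ruined_from _ _ _ = \bigcup_v (ruined_from k N.+1 u `&` [set w | Y k w = v])).
  apply: bigcupT_measurable => v; rewrite ruined_fromS; apply: measurableI => //.
  by case: ifP.
by apply/seteqP; split=> [w Ew|w [v _ []//]]; exists (Y k w).
Qed.

Fixpoint ruin_prob_by (N u : nat) : R :=
  if N is N'.+1 then
    \sum_(v < m.+1) f v * (if (u < v)%N then 1 else ruin_prob_by N' (u.+1 - v))
  else 0.

Lemma prob_prefix (k : nat) (y : nat -> nat) :
  P (\big[setI/setT]_(j <- iota 0 k) [set w | Y j w = y j]) = (\prod_(j < k) f (y j))%:E.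
Proof.
rewrite indY ?iota_uniq //.
rewrite -(big_mkord xpredT (fun j => f (y j))) /index_iota subn0 -prodEFin.
by apply: eq_bigr => j _; exact: prob_eq.
Qed.

(* Carrying the first k claims along as a cylinder lets the induction on N absorb the next
   claim, so that independence is only applied to cylinders. *)
Lemma prob_prefix_ruined (N k u : nat) (y : nat -> nat) :
  P (\big[setI/setT]_(j <- iota 0 k) [set w | Y j w = y j] `&` ruined_from k N u) =
  ((\prod_(j < k) f (y j)) * ruin_prob_by N u)%:E.
Proof.
elim: N k u y => [|N IH] k u y.
  rewrite (_ : ruined_from _ _ _ = set0) ?setI0 ?measure0 /= ?mulr0 //.
  by apply/seteqP; split.
set C := \big[_/_]_(_ <- _) _.
have mC : measurable C by rewrite /C; apply: big_ind => // *; exact: measurableI.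
rewrite (prob_total k); last exact/measurableI/measurable_ruined_from.
rewrite /= mulr_sumr -sumEFin; apply: eq_bigr => v _.
pose y' j := if j == k then v : nat else y j.
have CE : C `&` [set w | Y k w = v] =
    \big[setI/setT]_(j <- iota 0 k.+1) [set w | Y j w = y' j].
  rewrite -[k.+1 in RHS]addn1 iotaD big_cat big_seq1 add0n {2}/y' eqxx; congr (_ `&` _).
  rewrite /C big_seq [RHS]big_seq; apply: eq_bigr => j.
  by rewrite mem_iota /y' => /andP[_ jk]; rewrite ltn_eqF.
have prodE : \prod_(j < k) f (y j) * f v = \prod_(j < k.+1) f (y' j).
  rewrite big_ord_recr /= {2}/y' eqxx; congr (_ * _).
  by apply: eq_bigr => j _; rewrite /y' ltn_eqF.
rewrite -setIA ruined_fromS [X in C `&` X]setIC setIA CE mulrA prodE.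
case: ifP => _; last exact: IH.
by rewrite setIT mulr1 prob_prefix.
Qed.

(** Ruin is the increasing union of the finite-horizon events, so continuity from below applies;
    their probabilities are the case of an empty prefix in [prob_prefix_ruined]. *)
Lemma psi_cvg (u : nat) : ruin_prob_by N u @[N --> \oo] --> psi P Y u.
Proof.
have ruinE : ruin_event Y u = \bigcup_N ruined_from 0 N u.
  apply/seteqP; split=> [w [t [t0 ut]]|w [N _ /ruined_byP[t [t0 _ ut]]]]; last by exists t.
  by exists t => //; apply/ruined_byP; exists t.
have -> : (fun N => ruin_prob_by N u) = fine \o (P \o (fun N => ruined_from 0 N u)).
  apply/funext => N /=; have := prob_prefix_ruined N 0 u (fun=> 0%N).
  by rewrite big_nil setTI big_ord0 mul1r => ->.
apply: fine_cvg; rewrite /psi fineK ?ruinE.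
  apply: nondecreasing_cvg_mu => [N||N M NM].
  - exact: measurable_ruined_from.
  - by apply: bigcupT_measurable => N; exact: measurable_ruined_from.
  - apply/subsetPset => w /ruined_byP[t [t0 tN ut]]; apply/ruined_byP.
    by exists t; split=> //; exact: leq_trans NM.
apply: fin_num_measure.
by apply: bigcupT_measurable => N; exact: measurable_ruined_from.
Qed.

Lemma psi_first_step (u : nat) :
  psi P Y u = \sum_(v < m.+1) f v * (if (u < v)%N then 1 else psi P Y (u.+1 - v)).
Proof.
have H : ruin_prob_by N.+1 u @[N --> \oo] --> psi P Y u.
  by have := psi_cvg u; rewrite -cvg_shiftS.
apply: (cvg_unique _ H) => //=.
apply: cvg_big => [|v _]; first exact: add_continuous.
apply: cvgMr; case: ifP => _; [exact: cvg_cst|exact: psi_cvg].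
Qed.

(** If the value 0 had probability zero, the claim would be at least 1 almost surely, and so would
    its mean. *)
Lemma prob0_gt0 : (\int[P]_w ((Y 0%N w)%:R)%:E < 1)%E -> 0 < f 0%N.
Proof.
rewrite !ltNge; apply: contraNN => f0.
have {}f0 : P [set w | Y 0%N w = 0%N] = 0%E.
  by apply/eqP; rewrite eq_le measure_ge0 prob_eq lee_fin f0.
rewrite -[leLHS](@probability_setT _ _ _ P) -[P setT]mul1e -integral_cst //.
apply: ae_ge0_le_integral => //.
- move=> _ A mA; rewrite setTI.
  rewrite (_ : _ @^-1` _ = \bigcup_(v in [set v | A v%:R%:E]) [set w | Y 0%N w = v]).
    by apply: bigcup_measurable.
  by apply/seteqP; split=> [w Aw|w [v Av /= ->]] //; exists (Y 0%N w).
- exists [set w | Y 0%N w = 0%N]; split => // w /= /not_implyP[_ /negP].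
  by rewrite lee_fin -ltNge ltrn1 => /eqP; rewrite subn1.
Qed.

Lemma psi_recurrence (u : nat) : (0 < m)%N -> f 0%N != 0 ->
  psi P Y (u + m + 1) = \sum_(k < m) alpha f k * psi P Y (u + m - k).
Proof.
move=> m_gt0 f0; have := psi_first_step (u + m).
rewrite (eq_bigr (fun v : 'I__ => f v * psi P Y ((u + m).+1 - v))); last first.
  by move=> v _; rewrite ltnNge (leq_trans (leq_ord v)) ?leq_addl.
case: m m_gt0 => // n _.
(* The terms v = 0 and v = 1 are split off: the first contains psi(u+m+1), and the second contains
   psi(u+m), which is also the left side; this explains the special form of [alpha f 0]. *)
rewrite !big_ord_recl /= /alpha /= addn1 subn0 /bump /= !add1n subn1 /= => E.
apply: (mulfI f0).
rewrite mulrDr mulr_sumr [X in _ = _ + X](eq_bigr (fun i : 'I_n =>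
    - (f (1 + (1 + i))%N * psi P Y ((u + n.+1).+1 - (1 + (1 + i)))%N))); last first.
  by move=> i _; rewrite mulrA mulrN mulrCA mulfV // mulr1 mulNr subSS.
rewrite sumrN subn0 mulrA [f 0%N * (_ / _)]mulrC divfK // mulrBl mul1r.
by move: E; lra.
Qed.
End RuinProbability.

(** * The characteristic polynomial and the closed form of psi *)

Lemma umbral_ruin_char_poly (R : realType) (f : nat -> R) (m u : nat) (s : nat -> complex R) :
  umbral (complex R) s (ruin_char_poly f m * 'X^u) =
  s (m + u)%N - \sum_(k < m) ((alpha f k)%:C)%C * s (m.-1 - k + u)%N.
Proof.
rewrite /ruin_char_poly mulrBl mulr_suml -exprD linearB /= umbralXn.
rewrite [umbral _ _ (\sum_(_ < _) _)]linear_sum /=.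
by congr (_ - _); apply: eq_bigr => k _; rewrite -mulrA -exprD mul_polyC linearZ /= umbralXn.
Qed.

(** The value of the polynomial at 0 is its constant coefficient, - alpha_(m-1). *)
Lemma root_ruin_char_poly_neq0 (R : realType) (f : nat -> R) (m : nat) (z : complex R) :
  (0 < m)%N -> alpha f m.-1 != 0 -> root (ruin_char_poly f m) z -> z != 0.
Proof.
case: m => // n _ an /rootP pz; apply: contraNneq an => z0; move: pz; rewrite {}z0.
rewrite /ruin_char_poly hornerD hornerXn expr0n /= add0r hornerN horner_sum.
rewrite big_ord_recr /= subnn expr0 mulr1 hornerC big1 ?add0r.
  by move=> /eqP; rewrite oppr_eq0 fmorph_eq0.
by move=> i _; rewrite hornerM hornerXn expr0n subn_eq0 leqNgt ltn_ord mulr0.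
Qed.

Theorem theorem1 (d : measure_display) (T : measurableType d) (R : realType)
  (P : probability T R) (Y : nat -> T -> nat) (f : nat -> R) (m : nat) :
  (2 <= m)%N ->
  (forall j y, measurable [set w | Y j w = y]) ->
  mutually_independent_nat P Y ->
  (forall j y, fine (P [set w | Y j w = y]) = f y) ->
  (forall y, (m < y)%N -> f y = 0) ->
  0 < f m ->
  (\int[P]_w ((Y 0%N w)%:R)%:E < 1)%E ->
  (forall u : nat,
     psi P Y (u + m + 1) = \sum_(k < m) alpha f k * psi P Y (u + m - k))
  /\
  (forall (l : nat) (z : 'I_l -> complex R) (n : 'I_l -> nat),
     injective z ->
     (forall k, (0 < n k)%N) ->
     ruin_char_poly f m = \prod_(k < l) ('X - (z k)%:P) ^+ n k ->
     exists b : 'I_l -> nat -> complex R,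
       forall u : nat, (1 <= u)%N ->
         ((psi P Y u)%:C)%C = \sum_(k < l) \sum_(j < n k) b k j * (u%:R) ^+ j * z k ^+ u).
Proof.
move=> m2 mY indY fY f_eq0 fm EY.
have m0 : (0 < m)%N by exact: ltnW.
have f0 : f 0%N != 0 by rewrite gt_eqF // (prob0_gt0 _ _ _ _ _ _ mY fY).
have rec u : psi P Y (u + m + 1) = \sum_(k < m) alpha f k * psi P Y (u + m - k).
  exact: psi_recurrence.
split=> // l z n zinj n0 pE.
(* The lowest value in the recurrence at u = 0 is psi(1), so the sequence starts there. *)
pose s u := ((psi P Y u.+1)%:C)%C.
have z0 k : z k != 0.
  apply: (@root_ruin_char_poly_neq0 _ f m) => //.
    (* Since m >= 2, the index m-1 is positive and alpha_(m-1) = - f(m) / f(0), nonzero as f(m) >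
       0. *)
    rewrite /alpha ifN; last by rewrite -lt0n -ltnS prednK.
    by rewrite oppr_eq0 mulf_neq0 ?invr_eq0 // prednK // gt_eqF.
  by rewrite pE (bigD1 k) //= rootM /root horner_exp hornerXsubC subrr expr0n gtn_eqF ?eqxx.
have [|q [sq sE]] := linear_recurrence_solution _ s _ l z n _ zinj z0 pE.
  move=> u; rewrite umbral_ruin_char_poly {1}/s.
  have -> : (m + u).+1 = (u + m + 1)%N by lia.
  rewrite rec rmorph_sum /= -sumrB big1 // => k _; rewrite rmorphM /= /s.
  have -> : (m.-1 - k + u).+1 = (u + m - k)%N by have := ltn_ord k; lia.
  by rewrite subrr.
(* This undoes the shift: composing with X - 1 rewrites a polynomial in u as one in u + 1 of the
   same size, and dividing by z_k turns z_k^(u+1) into z_k^u. *)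
exists (fun k j => (q k \Po ('X - 1))`_j / z k) => -[//|u] _.
rewrite -[LHS]/(s u) sE; apply: eq_bigr => k _.
have -> : (q k).[u%:R] = (q k \Po ('X - 1)).[u.+1%:R].
  by rewrite horner_comp hornerD hornerX hornerN hornerC -natr1 addrK.
rewrite (@horner_coef_wide _ (n k)) ?size_comp_poly2 ?size_XsubC //.
rewrite mulr_suml; apply: eq_bigr => j _.
by rewrite exprS; field.
Qed.
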